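(* Let $n\ge 2$, let $\mathfrak g$ be of type $A_n^{(1)}$ with $I=\mathbb Z/(n+1)\mathbb Z$, and let $M=\prod_{k\ge0}\prod_{i\in I}Y_{i,k}^{y_{i,k}}\mathbf 1\in\mathcal M(\infty)$. For $k\ge 0$ let $(E_k)$ denote the system of linear equations $$a_{i,k}-a_{i-1,k}=\sum_{\ell=0}^{k}y_{i+\ell,\,k-\ell}\qquad(i\in I)$$ in integer unknowns $\{a_{i,k}\}_{i\in I}$ (first indices taken modulo $n+1$). Then $D(M)$ is computed by the following algorithm. (1) Find the maximum value $m$ such that there exists an $i\in I$ with $y_{i,m+1}\neq 0$. (2) Find the unique solution $\{a_{i,m}\}_{i\in I}$ of $(E_m)$ such that $a_{i,m}\in\mathbb Z_{\le0}$ for all $i\in I$ and such that there exists an $i\in I$ with $a_{i,m}=0$. Let these be the values of $a_{i,m}$. Set $k=m-1$. (3) If $k\ge0$, find the (componentwise) maximal solution $\{a_{i,k}\}_{i\in I}$ of $(E_k)$ such that $a_{i,k}\in\mathbb Z_{\le0}$ and $a_{i,k}\le a_{i-1,k+1}$ for all $i\in I$. Decrease $k$ by $1$. (4) Repeat step (3) until $k=-1$. After finding the values $a_{i,k}$ in this manner, $D(M)=\sum_{k=0}^{m}a_{0,k}$. (If $M=\mathbf 1$, so that no $m$ as in step (1) exists, the sum is read as the empty sum $0$.)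
   Context: Type $A_n^{(1)}$, $n\ge2$: $I=\{0,1,\dots,n\}$ identified with $\mathbb Z/(n+1)\mathbb Z$; Cartan matrix $C_{ii}=2$, $C_{ij}=-1$ if $j\equiv i\pm1 \bmod (n+1)$, and $C_{ij}=0$ otherwise. Modified Nakajima monomials: $\widehat{\mathcal M}$ is the set of monomials $M=\prod_{i\in I}\prod_{k\ge0}Y_{i,k}^{y_{i,k}}\mathbf 1$ in formal commuting variables $Y_{i,k}$ ($i\in I$, $k\ge 0$) times an additional formal commuting variable $\mathbf 1$, where $y_{i,k}\in\mathbb Z$ and all but finitely many $y_{i,k}$ are $0$. For such $M$ and $i\in I$ put $\langle h_i,\mathrm{wt}(M)\rangle=\sum_{k\ge0}y_{i,k}$, $\varphi_i(M)=\max\{\sum_{j=0}^k y_{i,j}:k\ge0\}$, $\varepsilon_i(M)=\varphi_i(M)-\langle h_i,\mathrm{wt}(M)\rangle$, $k_f=\min\{k\ge0:\varphi_i(M)=\sum_{j=0}^k y_{i,j}\}$, $k_e=\max\{k\ge0:\varphi_i(M)=\sum_{j=0}^k y_{i,j}\}$ (used only when $\varepsilon_i(M)>0$). Put (indices modulo $n+1$) $$A_{i,k}=Y_{i,k}\,Y_{i,k+1}\,Y_{i-1,k+1}^{-1}\,Y_{i+1,k}^{-1}.$$ The Kashiwara operators are $\widetilde f_iM=A_{i,k_f}^{-1}M$, and $\widetilde e_iM=A_{i,k_e}M$ if $\varepsilon_i(M)>0$, $\widetilde e_iM=0$ if $\varepsilon_i(M)=0$. $\mathcal M(\infty)$ is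 the connected component of $\widehat{\mathcal M}$, under application of the operators $\widetilde e_i,\widetilde f_i$ ($i\in I$), containing the monomial $\mathbf 1$ (all exponents $0$). It is known that $\mathcal M(\infty)$ is isomorphic to the crystal $B(\infty)$ as a $U_q'(\mathfrak g)$-crystal, with $\mathbf 1$ corresponding to the highest weight element; in particular every element of $\mathcal M(\infty)$ is of the form $\widetilde f_{b_1}\cdots\widetilde f_{b_\ell}\mathbf 1$. The function $D$: the weight lattice is $P=\bigoplus_{i\in I}\mathbb Z\Lambda_i\oplus\mathbb Z\delta$ with $\alpha_i=\sum_{j\in I}C_{ji}\Lambda_j$ for $i\ne0$ and $\alpha_0=\sum_{j\in I}C_{j0}\Lambda_j+\delta$. $D:\mathcal M(\infty)\to\mathbb Z$ is the function such that $\mathrm{wt}(M)=\sum_{i\in I}\bigl(\sum_{k\ge0}y_{i,k}\bigr)\Lambda_i+D(M)\delta$ is the affine weight function making $\mathcal M(\infty)$ a $U_q(\mathfrak g)$-crystal, i.e. $\mathrm{wt}(\mathbf 1)=0$ and $\mathrm{wt}(\widetilde f_iM)=\mathrm{wt}(M)-\alpha_i$ for all $i\in I$. Equivalently, if $M=\widetilde f_{b_1}\cdots\widetilde f_{b_\ell}\mathbf 1$, then $D(M)=-|\{1\le j\le\ell:b_j=0\}|$ (independent of the chosen expression). *)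

(* Defs.v *)
From HB Require Import structures.
From mathcomp Require Import all_boot all_order all_algebra.
From mathcomp Require Import finmap.
From mathcomp.multinomials Require Import monalg.

Set Implicit Arguments.
Unset Strict Implicit.
Unset Printing Implicit Defensive.
Import Order.TTheory GRing.Theory Num.Theory.
Local Open Scope ring_scope.

(* Everything is parametrized by n and meant for n >= 2.  The index set is     *)
(* 'Z_n.+1, which is Z/(n+1)Z as soon as n >= 1; its ring structure gives the  *)
(* indices modulo n+1.                                                         *)

Definition cartan (n : nat) (i j : 'Z_n.+1) : int :=
  if j == i then 2 else if (j == i + 1) || (j == i - 1) then -1 else 0.

(* Monomials in the Y_(i,k) with integer exponents form the free abelian group *)
(* on the pairs (i, k).  It is written additively: M@_(i, k) is the exponent   *)
(* y_(i,k), <<(i, k)>> is Y_(i,k), products become sums, and the monomial 1    *)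
(* is 0 (the extra variable occurs exactly once in every monomial, so it       *)
(* carries no information).                                                    *)
Notation monomial n := {malg int[('Z_n.+1 * nat)%type]}.

Section Crystal.
Variable n : nat.
Implicit Types (M : monomial n) (i : 'Z_n.+1) (k : nat).

Definition hwt i M : int := \sum_(p <- msupp M | p.1 == i) M@_p.

Definition psum i M k : int := \sum_(j < k.+1) M@_(i, nat_of_ord j).

(* All exponents at levels k >= depth M vanish, so the partial sums are        *)
(* constant from there on, and the extrema over all k >= 0 can be taken over   *)
(* 0 <= k <= depth M; see phi_ge, phi_ex, kfP and keP.                         *)
Definition depth M : nat := (\max_(p <- msupp M) p.2.+1)%N.

Definition phi i M : int :=
  \big[Num.max/psum i M 0]_(k < (depth M).+1) psum i M k.

Definition eps i M : int := phi i M - hwt i M.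

Definition kf i M : nat :=
  find (fun k => phi i M == psum i M k) (iota 0 (depth M).+1).

Definition ke i M : nat :=
  (\max_(k < (depth M).+1 | phi i M == psum i M k) k)%N.

Definition Amon i k : monomial n :=
  <<(i, k)>> + <<(i, k.+1)>> - <<(i - 1, k.+1)>> - <<(i + 1, k)>>.

Definition ftilde i M : monomial n := M - Amon i (kf i M).

Definition etilde i M : option (monomial n) :=
  if 0 < eps i M then Some (M + Amon i (ke i M)) else None.

Inductive Minf : monomial n -> Prop :=
| Minf_one : Minf 0
| Minf_f i M : Minf M -> Minf (ftilde i M)
| Minf_e i M M' : Minf M -> etilde i M = Some M' -> Minf M'.

(* The weight lattice: (l, d) is the weight \sum_i l i Lambda_i + d delta.     *)
Definition weight := ({ffun 'Z_n.+1 -> int} * int)%type.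

Definition alpha i : weight := ([ffun j => cartan j i], (i == 0)%:Z).

Definition wt (D : monomial n -> int) M : weight :=
  ([ffun i => hwt i M], D M).

(* D is a function on M(oo): its values elsewhere are irrelevant.              *)
Definition affine_weight (D : monomial n -> int) : Prop :=
  wt D 0 = 0 /\
  forall i M, Minf M -> wt D (ftilde i M) = wt D M - alpha i.

Definition E_system M k (a : {ffun 'Z_n.+1 -> int}) : Prop :=
  forall i, a i - a (i - 1) = \sum_(l < k.+1) M@_(i + l%:R, (k - l)%N).

Definition step1 M (m : nat) : Prop :=
  (exists i, M@_(i, m.+1) != 0) /\
  forall m', (exists i, M@_(i, m'.+1) != 0) -> (m' <= m)%N.

Definition step2 M (m : nat) (a : {ffun 'Z_n.+1 -> int}) : Prop :=
  unique (fun b : {ffun 'Z_n.+1 -> int} =>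
    [/\ E_system M m b, forall i, b i <= 0 & exists i, b i = 0]) a.

(* a' is the solution found at level k + 1.                                    *)
Definition step3_admissible M k (a' b : {ffun 'Z_n.+1 -> int}) : Prop :=
  [/\ E_system M k b, forall i, b i <= 0 & forall i, b i <= a' (i - 1)].

Definition step3 M k (a' a : {ffun 'Z_n.+1 -> int}) : Prop :=
  step3_admissible M k a' a /\
  forall b, step3_admissible M k a' b -> forall i, b i <= a i.

(* a k i is a_(i,k); only the values for k <= m are constrained.               *)
Definition algorithm M (m : nat) (a : nat -> {ffun 'Z_n.+1 -> int}) : Prop :=
  [/\ step1 M m, step2 M m (a m) &
      forall k, (k < m)%N -> step3 M k (a k.+1) (a k)].

Lemma lt_depth M i k : (i, k) \in msupp M -> (k < depth M)%N.
Proof. by move=> ik; rewrite /depth; apply: (@leq_bigmax_seq _ _ _ (fun p => p.2.+1) (i, k)). Qed.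

Lemma depthP M i k : (depth M <= k)%N -> M@_(i, k) = 0.
Proof.
move=> le_dk; apply/mcoeff_outdom/negP => ik.
by have := leq_trans (lt_depth ik) le_dk; rewrite ltnn.
Qed.

Lemma psum_depth i M k : (depth M <= k.+1)%N -> psum i M k = hwt i M.
Proof.
move=> le_dk; rewrite /psum /hwt.
pose s := [seq (i, j) | j <- iota 0 k.+1].
have us : uniq s by rewrite map_inj_uniq ?iota_uniq // => x y [].
have -> : \sum_(j < k.+1) M@_(i, nat_of_ord j) = \sum_(p <- s) M@_p.
  by rewrite big_map -[iota _ _]/(index_iota 0 k.+1) big_mkord.
rewrite -(big_filter (msupp M)) (bigID (fun p => p \in msupp M)) /=.
rewrite [X in _ + X]big1 ?addr0; last by move=> p; apply: mcoeff_outdom.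
rewrite -big_filter; apply: perm_big; apply: uniq_perm; rewrite ?filter_uniq ?fset_uniq //.
move=> [i' j]; rewrite !mem_filter /= andbC; case: (boolP (_ \in msupp M)) => [ij|]; last by rewrite !andbF.
rewrite !andbT; apply/mapP/eqP => [[j' _ [-> _]] // | ->].
exists j => //; rewrite mem_iota /= add0n; apply: leq_trans le_dk.
exact: lt_depth ij.
Qed.

Lemma psum_const i M k : (depth M <= k)%N -> psum i M k = psum i M (depth M).
Proof. by move=> dk; rewrite !psum_depth // leqW. Qed.

Lemma phi_ge i M k : psum i M k <= phi i M.
Proof.
wlog ltkd : k / (k < (depth M).+1)%N => [H|].
  have [|lt_dk] := leqP k (depth M); first by move/H.
  by rewrite (psum_const i (ltnW lt_dk)) H.
exact: (@le_bigmax _ _ _ _ (fun j : 'I__ => psum i M j) (Ordinal ltkd)).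
Qed.

Lemma phi_le_depth i M : exists2 k, (k <= depth M)%N & phi i M = psum i M k.
Proof.
rewrite /phi; elim/big_ind: _; first by exists 0%N.
  by move=> x y hx hy; case: (leP x y).
by move=> k _; exists k; rewrite // -ltnS.
Qed.

Lemma phi_ex i M : exists k, phi i M = psum i M k.
Proof. by have [k _ ->] := phi_le_depth i M; exists k. Qed.

Lemma kfP i M : phi i M = psum i M (kf i M) /\
  forall k, phi i M = psum i M k -> (kf i M <= k)%N.
Proof.
pose P k := phi i M == psum i M k.
have hP : has P (iota 0 (depth M).+1).
  by have [k dk e] := phi_le_depth i M; apply/hasP; exists k; rewrite ?mem_iota ?ltnS // /P e.
split.
  have := nth_find 0%N hP; rewrite nth_iota ?add0n => [/eqP //|].
  by rewrite -[X in (_ < X)%N](size_iota 0) -has_find.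
move=> k e; rewrite leqNgt; apply/negP => lt_k.
have ltd : (k < (depth M).+1)%N.
  by apply: ltn_trans lt_k _; rewrite -[X in (_ < X)%N](size_iota 0) -has_find.
by have := before_find 0%N lt_k; rewrite nth_iota // add0n e eqxx.
Qed.

Lemma keP i M : 0 < eps i M -> phi i M = psum i M (ke i M) /\
  forall k, phi i M = psum i M k -> (k <= ke i M)%N.
Proof.
rewrite /eps subr_gt0 => lt_wt; split.
  have [k dk e] := phi_le_depth i M.
  rewrite /ke (bigop.bigmax_eq_arg (Ordinal (dk : k < (depth M).+1)%N)) /= ?e //.
  by case: arg_maxnP => /= [|j /eqP]; rewrite ?e.
move=> k e; have ltd : (k < (depth M).+1)%N.
  rewrite ltnS leqNgt; apply/negP => lt_dk.
  by move: lt_wt; rewrite e psum_depth ?ltxx // leqW // ltnW.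
by apply: (leq_bigmax_cond (Ordinal ltd)); rewrite /= e.
Qed.

End Crystal.

(* Main.v *)
Require Import Defs.
From HB Require Import structures.
From mathcomp Require Import all_boot all_order all_algebra.
From mathcomp Require Import finmap.
From mathcomp.multinomials Require Import monalg.
From mathcomp Require Import zify.
Set Implicit Arguments.
Unset Strict Implicit.
Unset Printing Implicit Defensive.
Import Order.TTheory GRing.Theory Num.Theory.
Local Open Scope ring_scope.

(** Every M reached from 1 by the operators comes with a factorization
    M = prod_(k,i) A_(i,k)^(a_(i,k)), obtained by recording which A_(i,k) were
    used, and D M is the total exponent sum_k a_(0,k) of the A_(0,k).  This
    factorization is not determined by M, because prod_i A_(i,k) = 1 for every
    k: comparing exponents of the Y's gives exactly the systems (E_k), which
    determine the a_(i,k) up to one additive constant per level k.  The theorem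
    says how to recover the right constants, and the reason is an invariant of
    the recorded factorization.

    Let b_(i,k) = a_(i-1,k+1) - a_(i,k) be the gaps.  They are always
    nonnegative, and at each level k at least one of them is zero.  (Read as
    multiplicities of segments, the b_(i,k) form an aperiodic multisegment.)
    The invariant is preserved because y_(i,k+1) = b_(i+1,k) - b_(i,k): the
    partial sums which define the operators on M walk up and down by these
    differences.  The step into its first maximum goes strictly up and the step
    out of it does not, which is what is needed to move one unit from
    b_(i+1,k-1) to b_(i,k) for k = k_f; the last maximum k = k_e serves in the
    same way for the opposite move ([aperiodic_ftilde], [aperiodic_etilde]).

    Nonnegative gaps mean a_(i,k) <= a_(i-1,k+1), the constraint of step (3),
    and a zero gap means that no positive constant can be added at level k, so
    that the recorded solution is the maximal one.  At the last nonzero level m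
    the next level is zero, and the zero gap becomes the normalization of
    step (2).  Hence the recorded a_(i,k) are an output of the algorithm
    ([aperiodic_algorithm]), and its output is unique ([algorithm_unique]). *)

Section Factorizations.
Variable n : nat.
Local Notation I := 'Z_n.+1.
Implicit Types (M : monomial n) (a : nat -> I -> int) (i j : I) (k l : nat).

(** * The cyclic index set *)

Lemma addr1_neq i : (i + 1 == i) = false.
Proof. by rewrite -[X in _ == X]addr0 (inj_eq (addrI i)) oner_eq0. Qed.

Lemma subr1_neq i : (i - 1 == i) = false.
Proof. by rewrite subr_eq eq_sym addr1_neq. Qed.

Lemma cyclic_constant (f : I -> int) :
  (forall i, f i = f (i - 1)) -> forall i j, f i = f j.
Proof.
move=> fS; suff f0 i : f i = f 0 by move=> i j; rewrite !f0.
rewrite -(natr_Zp i); elim: (nat_of_ord i) => // k <-.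
by rewrite fS -natr1 addrK.
Qed.

(** * Factorizations into the A_(i,k) *)

(** The exponent of Y_(i,k) in prod_(l,j) A_(j,l)^(a_(j,l)).  The level comes
    first in a, as in the output of the algorithm. *)
Definition exponent a i k : int :=
  a k i - a k (i - 1) - (if k is l.+1 then a l (i + 1) - a l i else 0).

Definition factors a M := forall i k, M@_(i, k) = exponent a i k.

Definition vanishes_from a K := forall k i, (K <= k)%N -> a k i = 0.

Definition gap a k i : int := a k.+1 (i - 1) - a k i.

Definition aperiodic a :=
  (forall k i, 0 <= gap a k i) /\ (forall k, exists i, gap a k i = 0).

Definition shift_at a i0 k0 (x : int) : nat -> I -> int :=
  fun k i => a k i + x *+ ((k == k0) && (i == i0)).

(** The partial sums of the exponents at i are thus, up to their initial value,
    a walk whose steps are differences of neighbouring gaps. *)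
Lemma exponentS a i k : exponent a i k.+1 = gap a k (i + 1) - gap a k i.
Proof. by rewrite /exponent /gap addrK; lia. Qed.

Lemma factors0 : factors (fun _ _ => 0) 0.
Proof. by move=> i [|k]; rewrite mcoeff0 /exponent !subr0. Qed.

Lemma mcoeff_Amon i k j l : (Amon i k)@_(j, l) =
  ((j == i) && (l == k))%:R + ((j == i) && (l == k.+1))%:R
  - ((j == i - 1) && (l == k.+1))%:R - ((j == i + 1) && (l == k))%:R.
Proof.
(* With variables in place of i - 1 and i + 1, matching does not unfold the
   arithmetic of Z/(n+1)Z. *)
rewrite /Amon; move: (i - 1) (i + 1) => i' i''.
have U p : (<<p>> : monomial n)@_(j, l) = ((j == p.1) && (l == p.2))%:R.
  by rewrite mcoeffU eq_sym; case: p.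
by rewrite 2!mcoeffB mcoeffD; congr (_ + _ - _ - _); apply: U.
Qed.

Lemma factors_shift a M i k (x : int) : factors a M ->
  factors (shift_at a i k x) (M + Amon i k *~ x).
Proof.
move=> aM j l; rewrite mcoeffD aM raddfMz /= mcoeff_Amon /exponent /shift_at.
have -> : (j - 1 == i) = (j == i + 1) by rewrite subr_eq.
case: l => [|l]; rewrite ?eqSS.
  by rewrite !andbF; do !case: eqP => _ /=; lia.
have -> : (j + 1 == i) = (j == i - 1) by rewrite [RHS]eq_sym subr_eq eq_sym.
by rewrite ![(l == k) && _]andbC ![(l.+1 == k) && _]andbC;
   case: (j == i); case: (j == i + 1); case: (j == i - 1);
   case: (l == k); case: (l.+1 == k) => /=; lia.
Qed.

(** * The operators invert each other *)

Lemma psumS i M k : psum i M k.+1 = psum i M k + M@_(i, k.+1).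
Proof. by rewrite /psum big_ord_recr. Qed.

Lemma psum_addA i M k k0 :
  psum i (M + Amon i k0) k = psum i M k + (k0 <= k)%:R + (k0 < k)%:R.
Proof.
elim: k => [|k IH].
  rewrite /psum !big_ord1 mcoeffD mcoeff_Amon eqxx ![i == _]eq_sym.
  by rewrite subr1_neq addr1_neq /=; lia.
rewrite !psumS IH mcoeffD mcoeff_Amon eqxx ![i == _]eq_sym subr1_neq addr1_neq.
by rewrite /=; lia.
Qed.

(** The weight axiom for D speaks of f only; this identity transports it to e.
    Multiplication by A_(i,K), K the last maximum of the partial sums, raises
    them by 0 before K, by 1 at K and by 2 after K.  As they are smaller than
    the maximum after K, the position K becomes the first maximum. *)
Lemma ftilde_etilde i M M' : etilde i M = Some M' -> ftilde i M' = M.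
Proof.
rewrite /etilde; case: ifP => // eps_gt0 [<-].
have [phiE ke_max] := keP eps_gt0.
set K := ke i M in phiE ke_max *; set N := M + _.
have NK : psum i N K = phi i M + 1 by rewrite psum_addA phiE; lia.
have N_le k : psum i N k <= psum i N K.
  rewrite NK psum_addA; have := phi_ge i M k.
  have [ltKk|_] := ltnP K k; last by lia.
  have : phi i M <> psum i M k by move/ke_max; lia.
  by lia.
have phiN : phi i N = psum i N K.
  by apply/le_anti; rewrite phi_ge andbT; have [k ->] := phi_ex i N.
have [kfE kf_min] := kfP i N.
have kfK : kf i N = K.
  apply/eqP; rewrite eqn_leq kf_min //= leqNgt; apply/negP => lt_kfK.
  have := phi_ge i M (kf i N); move: kfE.
  by rewrite phiN NK psum_addA; lia.
by rewrite /ftilde kfK addrK.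
Qed.

(** * Aperiodicity is preserved *)

Lemma gap_shift a i0 k0 x k i : gap (shift_at a i0 k0 x) k i =
  gap a k i + x *+ ((k.+1 == k0) && (i == i0 + 1)) - x *+ ((k == k0) && (i == i0)).
Proof.
by rewrite /gap /shift_at subr_eq; case: (_ && _); case: (_ && _); lia.
Qed.

Lemma psum_gap a M i k : factors a M ->
  psum i M k.+1 = psum i M k + (gap a k (i + 1) - gap a k i).
Proof. by move=> aM; rewrite psumS aM exponentS. Qed.

(** With K = kf i M, the gap at (K, i) gains one unit and the gap at
    (K - 1, i + 1) loses one.  The strict rise into the first maximum makes the
    lost unit available.  Since the walk does not rise out of K, if the gap at
    (K, i) was the zero of level K then the gap at (K, i + 1) is also zero, and
    it survives. *)
Lemma aperiodic_ftilde a M i : factors a M -> aperiodic a ->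
  aperiodic (shift_at a i (kf i M) (-1)).
Proof.
move=> aM [gap_ge0 gap0]; have [phiE kf_min] := kfP i M.
set K := kf i M in phiE kf_min *.
have rise k : k.+1 = K -> gap a k i < gap a k (i + 1).
  move=> kK; have := phi_ge i M k; have := psum_gap i k aM; rewrite kK -phiE.
  have : phi i M <> psum i M k by move/kf_min; lia.
  by lia.
have fall : gap a K (i + 1) <= gap a K i.
  by have := phi_ge i M K.+1; rewrite (psum_gap i K aM) phiE; lia.
split=> [k j|k].
  rewrite gap_shift; have := gap_ge0 k j.
  case: (eqVneq k.+1 K) => [kK|_] /=; case: (eqVneq j (i + 1)) => [->|_] /=;
    try lia.
  by have := rise _ kK; have := gap_ge0 k i; lia.
have [j gj] := gap0 k.
have [kK|nkK] := eqVneq k K.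
  exists (if j == i then i + 1 else j); rewrite gap_shift kK.
  case: ifP => [/eqP ji|->] /=; last by rewrite -kK gj; lia.
  rewrite addr1_neq; move: fall (gap_ge0 K (i + 1)) gj; rewrite -kK ji; lia.
have [kK|nkK'] := eqVneq k.+1 K; last first.
  by exists j; rewrite gap_shift (negPf nkK) (negPf nkK') gj.
exists j; rewrite gap_shift (negPf nkK) kK eqxx /=.
case: eqP => [ji|_]; last by rewrite gj.
by have := rise _ kK; have := gap_ge0 k i; rewrite -ji gj; lia.
Qed.

(** The mirror image of [aperiodic_ftilde]: the strict fall out of the last
    maximum K = ke i M provides the unit which the gap at (K, i) loses, and the
    walk does not fall into K, so that the gap at (K - 1, i) can replace the
    one at (K - 1, i + 1) as the zero of its level. *)
Lemma aperiodic_etilde a M i : 0 < eps i M -> factors a M -> aperiodic a ->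
  aperiodic (shift_at a i (ke i M) 1).
Proof.
move=> eps_gt0 aM [gap_ge0 gap0]; have [phiE ke_max] := keP eps_gt0.
set K := ke i M in phiE ke_max *.
have fall : gap a K (i + 1) < gap a K i.
  have := phi_ge i M K.+1; have := psum_gap i K aM; rewrite -phiE.
  have : phi i M <> psum i M K.+1 by move/ke_max; lia.
  by lia.
have rise k : k.+1 = K -> gap a k i <= gap a k (i + 1).
  move=> kK; have := phi_ge i M k; have := psum_gap i k aM; rewrite kK -phiE.
  by lia.
split=> [k j|k].
  rewrite gap_shift; have := gap_ge0 k j.
  case: (eqVneq k K) => [->|_] /=; case: (eqVneq j i) => [->|_] /=; try lia.
  by have := gap_ge0 K (i + 1); lia.
have [j gj] := gap0 k.
have [kK|nkK] := eqVneq k.+1 K.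
  exists (if j == i + 1 then i else j); rewrite gap_shift kK.
  have -> : (k == K) = false by lia.
  case: ifP => [/eqP ji|->] /=; last by rewrite gj; lia.
  rewrite eq_sym addr1_neq.
  by move: (rise _ kK) (gap_ge0 k i) gj; rewrite ji; lia.
have [kK|nkK'] := eqVneq k K; last first.
  by exists j; rewrite gap_shift (negPf nkK) (negPf nkK') gj.
exists j; rewrite gap_shift (negPf nkK) kK eqxx /=.
case: eqP => [ji|_]; last by rewrite -kK gj.
by move: fall (gap_ge0 K (i + 1)) gj; rewrite -kK ji; lia.
Qed.

(** * The affine weight counts the A_(0,k) *)

Lemma sum_vanishes_from a K L i : vanishes_from a K -> (K <= L)%N ->
  \sum_(k < L) a k i = \sum_(k < K) a k i.
Proof.
move=> aK /subnKC <-; rewrite big_split_ord /= [X in _ + X]big1 ?addr0 //.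
by move=> k _; rewrite aK ?leq_addr.
Qed.

Lemma sum_shift_at a i0 k0 x i L : (k0 < L)%N ->
  \sum_(k < L) shift_at a i0 k0 x k i = \sum_(k < L) a k i + x *+ (i == i0).
Proof.
move=> ltkL; rewrite big_split /=; congr (_ + _).
rewrite (bigD1 (Ordinal ltkL)) //= eqxx big1 ?addr0 // => k.
by rewrite -val_eqE /= => /negPf->.
Qed.

Definition has_aperiodic_factorization (D : monomial n -> int) M := exists a K,
  [/\ factors a M, aperiodic a, vanishes_from a K &
      D M = \sum_(k < K) a k 0].

Lemma aperiodic_factorization_shift (D : monomial n -> int) M M' a K i k x :
    factors a M -> vanishes_from a K -> D M = \sum_(l < K) a l 0 ->
    aperiodic (shift_at a i k x) -> M' = M + Amon i k *~ x ->
    D M' = D M + x *+ (i == 0) ->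
  has_aperiodic_factorization D M'.
Proof.
move=> aM aK DM per -> DM'.
exists (shift_at a i k x), (maxn K k.+1); split => //.
- exact: factors_shift.
- move=> l j; rewrite geq_max => /andP[Kl kl].
  by rewrite /shift_at aK // gtn_eqF.
- rewrite sum_shift_at ?leq_maxr // (sum_vanishes_from _ aK) ?leq_maxl //.
  by rewrite DM' DM eq_sym.
Qed.

Lemma Minf_aperiodic_factorization D M : affine_weight D -> Minf M ->
  has_aperiodic_factorization D M.
Proof.
move=> [D0 DF].
have Df i N : Minf N -> D (ftilde i N) = D N - (i == 0)%:R.
  by move=> /(DF i) /(congr1 snd) /= ->; rewrite natz.
elim=> [|i N MN [a [K [aN per aK DN]]] | i N N' MN [a [K [aN per aK DN]]] eN].
- exists (fun _ _ => 0), 0%N; split => //; first exact: factors0.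
    by split=> [k i|k]; [rewrite /gap subrr | exists 0; rewrite /gap subrr].
  by rewrite big_ord0; case: D0.
- apply: (aperiodic_factorization_shift aN aK DN (aperiodic_ftilde i aN per)).
    by rewrite mulrN1z.
  by rewrite Df //; congr (_ + _); case: (i == 0).
- have MN' := Minf_e MN eN; have fN' := ftilde_etilde eN.
  move: (eN); rewrite /etilde; case: ifP => // eps_gt0 [N'E].
  apply: (aperiodic_factorization_shift aN aK DN (aperiodic_etilde eps_gt0 aN per)).
    by rewrite -N'E.
  by rewrite -{1}fN' Df // subrK.
Qed.

(** * The recorded factorization is the output of the algorithm *)

(** The sum in (E_k) telescopes along the diagonal (i + l, k - l). *)
Lemma E_system_factors a M k : factors a M -> E_system M k [ffun i => a k i].
Proof.
move=> aM i; rewrite !ffunE; elim: k i => [|k IH] i.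
  by rewrite big_ord1 addr0 aM /exponent subr0.
rewrite big_ord_recl addr0 aM /exponent.
rewrite (eq_bigr (fun l : 'I_k.+1 => M@_(i + 1 + l%:R, (k - l)%N))).
  by rewrite -IH addrK subrK.
by move=> l _; rewrite /= /bump leq0n add1n -nat1r addrA.
Qed.

Lemma E_system_diff M k (b c : {ffun I -> int}) :
  E_system M k b -> E_system M k c -> forall i j, b i - c i = b j - c j.
Proof.
move=> bE cE; apply: cyclic_constant => i.
by have := bE i; rewrite -cE; lia.
Qed.

(** Gaps are nonnegative, so exponents increase along a diagonal towards
    levels where they vanish. *)
Lemma aperiodic_le0 a K : aperiodic a -> vanishes_from a K ->
  forall k i, a k i <= 0.
Proof.
move=> [gap_ge0 _] aK k i; have [d] := ubnP (K - k).
elim: d k i => // d IH k i leKd.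
have [/aK ->//|ltkK] := leqP K k.
by have := gap_ge0 k i; have := IH k.+1 (i - 1); rewrite /gap; lia.
Qed.

Lemma vanishes_from_last a K : vanishes_from a K ->
  (forall k i, a k i = 0) \/
  exists m, (exists i, a m i != 0) /\ vanishes_from a m.+1.
Proof.
elim: K => [|K IH] aK; first by left=> k i; apply: aK.
have [/existsP ex|/existsPn a0] := boolP [exists i, a K i != 0].
  by right; exists K.
apply: IH => k i; rewrite leq_eqVlt => /predU1P[<-|/aK//].
by have := a0 i; rewrite negbK => /eqP.
Qed.

(** Solutions of one system differ by a constant, so one index where a bound is
    attained settles both maximality and uniqueness: the zero gap at each level
    is such an index.  For step (1), a zero of level m together with a nonzero
    value shows that level m is not constant, and then the exponents at level
    m + 1 cannot all vanish. *)
Lemma aperiodic_algorithm a M m : factors a M -> aperiodic a ->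
    vanishes_from a m.+1 -> (exists i, a m i != 0) ->
  algorithm M m (fun k => [ffun i => a k i]).
Proof.
move=> aM per am [i1 ai1]; have a_le0 := aperiodic_le0 per am.
have [gap_ge0 gap0] := per.
have [i0] := gap0 m; rewrite /gap am // => /eqP; rewrite sub0r oppr_eq0 => /eqP ai0.
split.
- split.
    apply/existsP; apply/existsPn => M0.
    suff aconst : forall i j, a m i = a m j by rewrite (aconst i1 i0) ai0 in ai1.
    apply: cyclic_constant => i; have := M0 (i - 1).
    by rewrite negbK aM /exponent !(am m.+1) // subrK => /eqP; lia.
  move=> m' [i]; rewrite aM leqNgt; apply: contra => ltmm'.
  by rewrite /exponent !am //; lia.
- split.
    split; [exact: E_system_factors | by move=> i; rewrite ffunE |].
    by exists i0; rewrite ffunE.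
  move=> b [bE b_le0 [j bj]]; apply/ffunP => i.
  have diff := E_system_diff bE (E_system_factors m aM).
  have := diff j i; have := diff j i0; have := b_le0 i0; have := a_le0 m j.
  by rewrite !ffunE ai0 bj; move: (b i) (b i0) (a m j) (a m i); lia.
- move=> k _; split.
    split; [exact: E_system_factors | by move=> i; rewrite ffunE |].
    by move=> i; rewrite !ffunE -subr_ge0; apply: gap_ge0.
  move=> b [bE _ b_le] i; have [j gj] := gap0 k.
  have := E_system_diff bE (E_system_factors k aM) i j.
  by have := b_le j; move: gj; rewrite /gap !ffunE; lia.
Qed.

Lemma algorithm_unique M m m' (a a' : nat -> {ffun I -> int}) :
    algorithm M m a -> algorithm M m' a' ->
  m = m' /\ forall k, (k <= m)%N -> a k = a' k.
Proof.
move=> [[ex max] s2 s3] [[ex' max'] s2' s3'].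
have mm' : m = m' by apply/eqP; rewrite eqn_leq max' // max.
split=> // k lekm; rewrite -{}mm' in s2' s3'.
have [d] := ubnP (m - k); elim: d k lekm => // d IH k lekm ltd.
have [kem|ltkm] := eqVneq k m.
  by rewrite kem; case: s2 => _; apply; case: s2'.
have {}ltkm : (k < m)%N by rewrite ltn_neqAle ltkm.
have eqS : a k.+1 = a' k.+1 by apply: IH; lia.
have [adm up] := s3 _ ltkm; have [adm' up'] := s3' _ ltkm.
by apply/ffunP => i; apply/le_anti; rewrite up ?up' // -?eqS // eqS.
Qed.

End Factorizations.

Theorem theorem3p8 (n : nat) (hn : (2 <= n)%N)
    (D : monomial n -> int) (hD : affine_weight D)
    (M : monomial n) (hM : Minf M) :
  (M = 0 -> D M = 0) /\
  (M <> 0 ->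
    (exists m a, algorithm M m a) /\
    (forall m a, algorithm M m a -> D M = \sum_(k < m.+1) a (k : nat) 0)).
Proof.
split=> [->|M_neq0]; first by case: hD => -[].
have [a [K [aM per aK DM]]] := Minf_aperiodic_factorization hD hM.
have [a0|[m [am_neq0 am]]] := vanishes_from_last aK.
  case: M_neq0; apply/malgP => -[i k].
  by rewrite aM mcoeff0; case: k => [|k]; rewrite /exponent !a0 !subr0.
have alg := aperiodic_algorithm aM per am am_neq0.
split=> [|m' a' alg']; first by exists m, (fun k => [ffun i => a k i]).
have [<- a'E] := algorithm_unique alg alg'.
have -> : D M = \sum_(k < m.+1) a k 0.
  rewrite DM -(@sum_vanishes_from _ _ _ (maxn K m.+1) _ aK) ?leq_maxl //.
  by rewrite (sum_vanishes_from _ am) ?leq_maxr.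
by apply: eq_bigr => k _; rewrite -a'E ?ffunE // -ltnS.
Qed.
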